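(* For all positive integers $n,d$ we have $g(n,d)\leq n+3d-3$. Equivalently, every $n$-vertex graph $G$ such that $\deg_G(u)+\deg_G(v)\geq n+3d-3$ for every pair of distinct non-adjacent vertices $u,v$ is $d$-rigid.
   Context: All graphs are finite and simple. A graph $G$ is $d$-rigid if some (equivalently every) generic $d$-dimensional bar-and-joint framework $(G,p)$ (with $p:V(G)\to\mathbb{R}^d$ having coordinates algebraically independent over $\mathbb{Q}$) is rigid, i.e. admits no continuous edge-length-preserving motion that changes some pairwise distance between vertices. For a graph $G=(V,E)$, $\eta(G)=\min_{uv\notin E,\,u\neq v}(\deg_G(u)+\deg_G(v))$ (taken as $+\infty$ if $G$ is complete). For $n,d\in\mathbb{N}$, $g(n,d)$ is the smallest integer such that every $n$-vertex graph $G$ with $\eta(G)\geq g(n,d)$ is $d$-rigid. *)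

(* Defs.v *)
From HB Require Import structures.
From mathcomp Require Import all_boot all_order all_algebra.
From mathcomp Require Import reals.
From mathcomp Require Import mpoly.
Set Implicit Arguments. Unset Strict Implicit. Unset Printing Implicit Defensive.
Import Order.TTheory GRing.Theory Num.Theory.
Local Open Scope ring_scope.

Definition simple_graph (n : nat) (e : rel 'I_n) : Prop :=
  (forall u v, e u v = e v u) /\ (forall u, ~~ e u u).

Definition deg (n : nat) (e : rel 'I_n) (u : 'I_n) : nat := #|[set v | e u v]|.

Definition eta_ge (n : nat) (e : rel 'I_n) (k : nat) : Prop :=
  forall u v : 'I_n, u != v -> ~~ e u v -> (k <= deg e u + deg e v)%N.

(* A d-dimensional configuration of n points: row i of P is p(i) in R^d. *)

Definition dist2 (R : realType) (n d : nat) (P : 'M[R]_(n, d)) (u v : 'I_n) : R :=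
  \sum_(k < d) (P u k - P v k) ^+ 2.

Definition generic (R : realType) (n d : nat) (P : 'M[R]_(n, d)) : Prop :=
  forall q : {mpoly rat[n * d]}, q != 0 ->
    mmap (ratr : rat -> R) (fun k => mxvec P 0 k) q != 0.

Definition continuous_on01 (R : realType) (n d : nat) (f : R -> 'M[R]_(n, d)) : Prop :=
  forall t : R, 0 <= t <= 1 -> forall eps : R, 0 < eps ->
    exists2 delta : R, 0 < delta &
      forall s : R, 0 <= s <= 1 -> `|s - t| < delta ->
        forall i j, `|f s i j - f t i j| < eps.

Definition framework_rigid (R : realType) (n d : nat) (e : rel 'I_n)
    (P : 'M[R]_(n, d)) : Prop :=
  ~ exists f : R -> 'M[R]_(n, d),
      [/\ continuous_on01 f, f 0 = P,
          (forall t, 0 <= t <= 1 -> forall u v, e u v -> dist2 (f t) u v = dist2 P u v) &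
          exists t, exists u, exists v,
            0 <= t <= 1 /\ dist2 (f t) u v != dist2 P u v].

Definition d_rigid (R : realType) (n d : nat) (e : rel 'I_n) : Prop :=
  forall P : 'M[R]_(n, d), generic P -> framework_rigid e P.

(* Main.v *)
Require Import Defs.
From mathcomp Require Import classical_sets.
From HB Require Import structures.
From mathcomp Require Import all_boot all_order all_algebra.
From mathcomp Require Import reals.
From mathcomp Require Import mpoly.
From mathcomp Require Import perm generic_quotient ring lra zify.
Import Order.TTheory GRing.Theory Num.Theory.
Set Implicit Arguments. Unset Strict Implicit. Unset Printing Implicit Defensive.
Local Open Scope ring_scope.

(** Cone the framework: with [P = (p, 1)], a motion is an [N] such that [Q = P N^T + N P^T] vanishes
    on the diagonal and on the edges.  Suppose the generic framework over the field of rational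
    functions has a nontrivial motion, and take [Q <> 0] of minimal support, so that [Q] is unique up
    to scaling among the motions with its zeros.  Write [Q = X M^T + M X^T] with [X = P L] of [K]
    columns, [K] minimal.  Differentiating in the coordinates of [P] shows that [(X M)] has rank
    [2 K]: a linear relation would be isotropic, and could be removed by a trivial motion, which
    lowers [K].  Differentiating [Q] also shows that a stress [W] of [X], i.e. a symmetric matrix
    supported on the zeros of [Q] with [W X = 0], satisfies [W M = 0] as soon as [(D - K) K] further
    linear conditions hold.  Choose [2 K] rows [J] on which [(X M)] is invertible.  The symmetric
    matrices supported on zeros of [Q] meeting [J] then embed properly into a space of dimension
    [n K + (D - K) K], [D] being the number of columns of [P].  As [Q] is invertible on [J], some permutation of [J] maps each vertex to a
    nonneighbour, so the degree condition bounds the sum of the degrees over [J] from below, and the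
    two counts contradict each other.
    For real frameworks, rank is maximal at generic points and is determined by the pairwise
    distances, and if [p] and [q] have equal edge lengths then [p - q] is an infinitesimal motion of
    [(p + q) / 2]. *)

(** * Motions of the coned framework over a field with derivations *)

Section LinearMotions.
Variable F : fieldType.
Implicit Types n D K : nat.

Definition symprod n K (X Y : 'M[F]_(n, K)) : 'M[F]_n := X *m Y^T + Y *m X^T.

Lemma symprodE n K (X Y : 'M[F]_(n, K)) a b :
  symprod X Y a b = \sum_i (X a i * Y b i + Y a i * X b i).
Proof. by rewrite !mxE big_split; congr (_ + _); apply: eq_bigr => i _; rewrite !mxE. Qed.

Lemma symprodC n K (X Y : 'M[F]_(n, K)) : symprod X Y = symprod Y X.
Proof. exact: addrC. Qed.

Lemma symprod_sym n K (X Y : 'M[F]_(n, K)) a b : symprod X Y a b = symprod X Y b a.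
Proof. by rewrite !symprodE; apply: eq_bigr => i _; ring. Qed.

Lemma symprodDr n K (X Y Z : 'M[F]_(n, K)) : symprod X (Y + Z) = symprod X Y + symprod X Z.
Proof. by rewrite /symprod linearD mulmxDr mulmxDl addrACA. Qed.

Lemma symprodZr n K (X Y : 'M[F]_(n, K)) c : symprod X (c *: Y) = c *: symprod X Y.
Proof. by rewrite /symprod linearZ -scalemxAr -scalemxAl scalerDr. Qed.

Lemma symprodBr n K (X Y Z : 'M[F]_(n, K)) : symprod X (Y - Z) = symprod X Y - symprod X Z.
Proof. by rewrite symprodDr -scaleN1r symprodZr scaleN1r. Qed.

Lemma symprod_mulmxl n D K (X : 'M[F]_(n, D)) (L : 'M_(D, K)) (Y : 'M_(n, K)) :
  symprod (X *m L) Y = symprod X (Y *m L^T).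
Proof. by rewrite /symprod !trmx_mul trmxK !mulmxA. Qed.

(** These are the trivial motions: they can be added to [M] without changing [Q], a freedom used
    below to shrink factorizations of [Q]. *)
Lemma symprod_alt n K (X : 'M[F]_(n, K)) (A : 'M_K) :
  A^T = - A -> symprod X (X *m A) = 0.
Proof. by move=> hA; rewrite /symprod trmx_mul hA mulNmx mulmxN mulmxA addNr. Qed.

Lemma mxtrace_symprod n K (W : 'M[F]_n) (X Y : 'M_(n, K)) : W^T = W ->
  \tr (W *m symprod X Y) = \tr (Y^T *m W *m X) *+ 2.
Proof.
move=> hW; rewrite mulmxDr mxtraceD !mulmxA mxtrace_mulC mulmxA mulr2n; congr (_ + _).
by rewrite mxtrace_mulC mulmxA -mxtrace_tr !trmx_mul trmxK hW mulmxA.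
Qed.

Lemma mxtrace_eq0 m n (U : 'M[F]_(m, n)) : (forall Z : 'M_(n, m), \tr (U *m Z) = 0) -> U = 0.
Proof.
move=> hU; apply/matrixP => i j; rewrite mxE -(hU (delta_mx j i)).
rewrite /mxtrace (bigD1 i) //= !mxE (bigD1 j) //= !mxE !eqxx mulr1 big1 => [|k /negPf kj].
  rewrite addr0 big1 ?addr0 // => k /negPf ki.
  by rewrite mxE big1 // => l _; rewrite mxE ki andbF mulr0.
by rewrite !mxE kj mulr0.
Qed.

Definition vanishes_with n (Q S : 'M[F]_n) := forall a b, Q a b = 0 -> S a b = 0.
Definition avoids n (Q W : 'M[F]_n) := forall a b, Q a b != 0 -> W a b = 0.

Lemma mxtrace_avoids n (Q S W : 'M[F]_n) : W^T = W ->
  vanishes_with Q S -> avoids Q W -> \tr (W *m S) = 0.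
Proof.
move=> hW hS hA; rewrite /mxtrace big1 // => a _; rewrite mxE big1 // => b _.
have [Q0|Q1] := eqVneq (Q b a) 0; first by rewrite hS ?mulr0.
by rewrite -hW mxE hA ?mul0r.
Qed.

Definition derivation (delta : F -> F) :=
  {morph delta : x y / x + y} /\ forall x y, delta (x * y) = delta x * y + x * delta y.

Lemma derivation0 delta : derivation delta -> delta 0 = 0.
Proof. by case=> hD _; apply: (addIr (delta 0)); rewrite -hD !add0r. Qed.

Lemma derivation_sum delta I (r : seq I) (f : I -> F) : derivation delta ->
  delta (\sum_(i <- r) f i) = \sum_(i <- r) delta (f i).
Proof. by move=> hd; apply: (big_morph delta); [case: hd | exact: derivation0]. Qed.

(* Differentiation of vectors attached to the vertices, twisted by a rescaling of the vertices:
   the linear model of rigidity is invariant under rescaling each row. *)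
Definition vderiv n K delta (sigma : 'I_n -> F) (V : 'M[F]_(n, K)) : 'M_(n, K) :=
  \matrix_(a, i) (delta (V a i) + sigma a * V a i).

Lemma vderivM n D K delta sigma (V : 'M[F]_(n, D)) (L : 'M_(D, K)) : derivation delta ->
  vderiv delta sigma (V *m L) = vderiv delta sigma V *m L + V *m map_mx delta L.
Proof.
move=> hd; apply/matrixP => a i; rewrite !mxE derivation_sum // mulr_sumr -!big_split /=.
by apply: eq_bigr => j _; rewrite !mxE hd.2; ring.
Qed.

(** By the product rule the entry at [(a, b)] is the derivative of the entry of [symprod X Y] plus a
    multiple of that entry, so the zeros survive. *)
Lemma vanishes_with_vderiv n K delta sigma (X Y : 'M[F]_(n, K)) : derivation delta ->
  vanishes_with (symprod X Y)
    (symprod (vderiv delta sigma X) Y + symprod X (vderiv delta sigma Y)).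
Proof.
move=> hd a b S0; rewrite mxE.
suff -> : symprod (vderiv delta sigma X) Y a b + symprod X (vderiv delta sigma Y) a b =
    delta (symprod X Y a b) + (sigma a + sigma b) * symprod X Y a b.
  by rewrite S0 mulr0 addr0 derivation0.
rewrite !symprodE (derivation_sum _ _ hd) mulr_sumr -!big_split /=.
by apply: eq_bigr => i _; rewrite !mxE hd.1 !hd.2; ring.
Qed.

(* An algebraic form of "the coordinates of [P] are independent transcendentals". *)
Definition free_config n D (P : 'M[F]_(n, D)) :=
  forall Y, exists delta sigma, derivation delta /\ vderiv delta sigma P = Y.

(** * Kernels, full rank of free configurations, and complements *)

Lemma nonfull_left_kernel n K (A : 'M[F]_(n, K)) (c : 'cV_K) : (K <= n)%N ->
  A *m c = 0 -> c != 0 -> exists2 v : 'rV_n, v != 0 & v *m A = 0.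
Proof.
move=> leKn Ac0 c0; have rkA : (\rank A < n)%N.
  apply: leq_trans leKn; rewrite ltn_neqAle rank_leq_col andbT; apply: contra c0 => fullA.
  have /row_fullP[B BA1] : row_full A by [].
  by rewrite -[c]mul1mx -BA1 -mulmxA Ac0 mulmx0.
have : kermx A != 0 by rewrite kermx_eq0 /row_free neq_ltn rkA.
case/rowV0Pn => v /sub_kermxP vA v0; exact: (ex_intro2 _ _ v).
Qed.

Lemma full_cols n K (A : 'M[F]_(n, K)) :
  (forall c : 'cV_K, A *m c = 0 -> c = 0) -> row_full A.
Proof.
move=> hA; rewrite /row_full -mxrank_tr -/(row_free A^T) -kermx_eq0; apply/eqP/row_matrixP => i.
apply: trmx_inj; rewrite row0 trmx0; apply: hA; apply: trmx_inj.
by rewrite trmx_mul trmxK trmx0 -row_mul mulmx_ker row0.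
Qed.

(** If [P c = 0] with [c != 0], some [v != 0] satisfies [v P = 0]. Differentiating [P c = 0] with
    the elementary matrix at [(a, i)] as derivative of [P], then applying [v], leaves [v_a c_i = 0],
    where [a] and [i] index nonzero entries. *)
Lemma free_config_full n D (P : 'M[F]_(n, D)) : (D <= n)%N -> free_config P -> row_full P.
Proof.
move=> leDn freeP; apply: full_cols => c Pc0; apply/eqP/negPn/negP => c0.
have [v v0 vP] := nonfull_left_kernel leDn Pc0 c0.
case/matrix0Pn: (c0) => i [z ci]; case/matrix0Pn: (v0) => z' [a va].
have [delta [sigma [hd hP]]] := freeP (delta_mx a i).
have: v *m vderiv delta sigma (P *m c) = 0.
  rewrite Pc0; apply/matrixP => x y; rewrite !mxE big1 // => k _.
  by rewrite !mxE derivation0 // mulr0 addr0 mulr0.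
rewrite vderivM // hP mulmxDr [v *m (P *m _)]mulmxA vP mul0mx addr0 => /matrixP/(_ z' z).
rewrite !mxE (bigD1 a) //= big1 => [|k /negPf ka]; last first.
  by rewrite mxE big1 ?mulr0 // => l _; rewrite !mxE ka mul0r.
rewrite addr0 !mxE (bigD1 i) //= big1 => [|k /negPf ki].
  rewrite addr0 !mxE !eqxx mul1r => /eqP; rewrite mulf_eq0.
  by rewrite (negPf va) (negPf ci).
by rewrite !mxE ki andbF mul0r.
Qed.

Lemma symprod_full_eq0 n D (P Z : 'M[F]_(n, D)) : row_full P ->
  symprod P Z = 0 -> exists A, Z = P *m A.
Proof.
move=> /row_fullP[B BP] /(congr1 (mulmx B)); rewrite /symprod mulmx0 mulmxDr !mulmxA BP mul1mx.
move/(congr1 trmx); rewrite trmx0 linearD /= trmxK !trmx_mul trmxK => /eqP.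
by rewrite addr_eq0 => /eqP ->; exists (- (Z^T *m B^T)); rewrite mulmxN.
Qed.

(** The columns of [C] span a complement of the column space of [L]; their number [r = D - K] enters
    the final count. *)
Lemma col_complement D K (L : 'M[F]_(D, K)) : row_full L ->
  exists r (C : 'M_(D, r)), (r + K = D)%N /\
    forall W : 'M_(D, K), exists a t, W = L *m a + C *m t.
Proof.
move=> fullL; exists (\rank (L^T)^C)%MS, (row_base (L^T)^C)%MS^T; split.
  by rewrite mxrank_compl mxrank_tr (eqP fullL) subnK // -(eqP fullL) rank_leq_row.
move=> W; have /sub_addsmxP[[u1 u2] /= eW] : (W^T <= L^T + (L^T)^C)%MS.
  exact/submx_full/addsmx_compl_full.
exists u1^T, (u2 *m col_base (L^T)^C%MS)^T.
apply: trmx_inj; rewrite linearD /= !trmx_mul !trmxK eW; congr (_ + _).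
by rewrite -mulmxA mulmx_base.
Qed.

Hypothesis char2 : 2 != 0 :> F.

(* The derivative of [P L] is arbitrary up to the terms [(P C) t] coming from the variation of [L],
   and it is orthogonal to [W M], as one sees by pairing the derivative of [symprod (P L) M] with
   [W]. *)
Lemma stress_kills_motion n D K r (P : 'M[F]_(n, D)) (L : 'M_(D, K)) (C : 'M_(D, r))
    (M : 'M_(n, K)) (W : 'M_n) :
  free_config P -> row_full L ->
  (forall V : 'M_(D, K), exists a t, V = L *m a + C *m t) ->
  W^T = W -> avoids (symprod (P *m L) M) W ->
  W *m (P *m L) = 0 -> (P *m C)^T *m (W *m M) = 0 -> W *m M = 0.
Proof.
move=> freeP /row_fullP[B BL] hC hW avW WX WZ.
suff MW0 : M^T *m W = 0 by apply: trmx_inj; rewrite trmx_mul hW MW0 trmx0.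
apply: mxtrace_eq0 => Z.
(* Since [B *m L = 1], the derivative of [P *m L] becomes [Z] plus the contribution of [delta L]. *)
have [delta [sigma [hd hP]]] := freeP (Z *m B).
have := mxtrace_avoids hW (vanishes_with_vderiv sigma (X := P *m L) (Y := M) hd) avW.
rewrite mulmxDr mxtraceD !mxtrace_symprod // -[_ *m W *m (P *m L)]mulmxA WX mulmx0.
rewrite mxtrace0 mul0rn addr0 vderivM // hP.
have [a [t ->]] := hC (map_mx delta L).
have MZ : M^T *m W *m (P *m C) = 0.
  by apply: trmx_inj; rewrite !trmx_mul trmxK hW trmx0 -WZ trmx_mul.
have MX : M^T *m W *m (P *m L) = 0 by rewrite -mulmxA WX mulmx0.
rewrite -[Z *m B *m L]mulmxA BL mulmx1 !mulmxDr.
rewrite (mulmxA P) [M^T *m W *m (_ *m a)]mulmxA MX mul0mx add0r.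
rewrite (mulmxA P) [M^T *m W *m (_ *m t)]mulmxA MZ mul0mx addr0 => /eqP.
by rewrite -mulr_natr mulf_eq0 (negPf char2) orbF => /eqP.
Qed.

(* Holds when [Q] has minimal support among the nonzero motions with given zeros. *)
Definition unique_motion n D (P : 'M[F]_(n, D)) (Q : 'M_n) :=
  forall N, vanishes_with Q (symprod P N) -> exists c, symprod P N = c *: Q.

(* Moving [P] in the direction [tau b^T] forces [M] to move by [- tau g^T] up to motions, whereas the
   relation itself makes [M b] move by [tau (b^T g)]. *)
Lemma isotropic_relation n D (P M : 'M[F]_(n, D)) (b g : 'cV_D) : (2 * D <= n)%N ->
  free_config P -> unique_motion P (symprod P M) ->
  M *m b = P *m g -> b != 0 -> g^T *m b = 0.
Proof.
move=> le2Dn freeP uniq hb b0.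
have fullP : row_full P by apply: free_config_full => //; lia.
(* The relation makes [row_mx P M] rank deficient; as it has [2 D <= n] columns, a nonzero row [v]
   kills both [P] and [M]. *)
have [v v0 vPM] : exists2 v : 'rV_n, v != 0 & v *m row_mx P M = 0.
  apply: (@nonfull_left_kernel _ _ _ (col_mx (- g) b)); first lia.
    by rewrite mul_row_col mulmxN hb addNr.
  by rewrite col_mx_eq0 (negPf b0) andbF.
move: vPM; rewrite mul_mx_row => /eqP; rewrite row_mx_eq0 => /andP[/eqP vP /eqP vM].
case/matrix0Pn: (v0) => z [i]; rewrite (ord1 z) => vi; pose tau : 'cV[F]_n := delta_mx i 0.
have [delta [sigma [hd hP]]] := freeP (tau *m b^T).
pose dM := vderiv delta sigma M.
have eQ : symprod (tau *m b^T) M + symprod P dM = symprod P (dM + tau *m g^T).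
  rewrite [RHS]symprodDr addrC; congr (_ + _).
  rewrite symprod_mulmxl trmxK hb symprodC.
  by rewrite symprod_mulmxl.
have zQ : vanishes_with (symprod P M) (symprod P (dM + tau *m g^T)).
  by rewrite -eQ -hP; exact: vanishes_with_vderiv.
have [c hc] := uniq _ zQ.
have [A hA] : exists A, dM + tau *m g^T - c *: M = P *m A.
  by apply: symprod_full_eq0 => //; rewrite symprodBr hc symprodZr subrr.
have edM : dM = c *: M + P *m A - tau *m g^T.
  by rewrite -hA [c *: M + _]addrC subrK addrK.
have vP0 m (x : 'M_(_, m)) : v *m (P *m x) = 0 by rewrite mulmxA vP mul0mx.
have vM0 m (x : 'M_(_, m)) : v *m (M *m x) = 0 by rewrite mulmxA vM mul0mx.
have := congr1 (vderiv delta sigma) hb; rewrite !vderivM // -/dM hP.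
move/(congr1 (mulmx v)); rewrite !mulmxDr vP0 vM0 !addr0 edM.
rewrite mulmxBl mulmxDl -!mulmxA -scalemxAl mulmxBr mulmxDr -scalemxAr vP0 vM0 scaler0.
(* [E] compares the two derivatives after applying [v]: [v tau (g^T b)] equals its own negative,
   while [v tau] is the nonzero entry [v 0 i]. *)
rewrite !add0r => E; have gb : g^T *m b = b^T *m g.
  by rewrite [LHS]mx11_scalar [RHS]mx11_scalar -[g^T *m b]trmxK trmx_mul trmxK mxE.
have E2 : v *m (tau *m (g^T *m b)) *+ 2 = 0.
  by rewrite mulr2n {2}gb -E addrN.
move/matrixP/(_ 0 0): E2; rewrite [g^T *m b]mx11_scalar mul_mx_scalar -scalemxAr -colE !mxE.
move/eqP; rewrite -mulr2n -mulr_natr !mulf_eq0 (negPf char2) (negPf vi) !orbF => /eqP ->.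
exact: raddf0.
Qed.


(** * Shrinking a factorization of a motion *)

(** Split [N] into its column base and row base, and move the row base over to [M]; only [\rank N]
    columns remain. *)
Lemma symprod_factor n D K (P : 'M[F]_(n, D)) (L : 'M_(D, K)) (M : 'M_(n, K)) (N : 'M_K) :
  (\rank N < K)%N ->
  exists K' (L' : 'M_(D, K')) (M' : 'M_(n, K')),
    (K' < K)%N /\ symprod (P *m (L *m N)) M = symprod (P *m L') M'.
Proof.
move=> rkN; exists (\rank N), (L *m col_base N), (M *m (row_base N)^T); split=> //.
by rewrite -symprod_mulmxl -(mulmxA P) -(mulmxA L) mulmx_base.
Qed.

(** [1 - c w] is the projection along [c], hence singular; any matrix killing [c] absorbs it as a
    right factor, which makes [symprod_factor] applicable. *)
Lemma annihilator_factor K (c : 'cV[F]_K) : c != 0 ->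
  exists w : 'rV_K, w *m c = 1 /\ (\rank (1%:M - c *m w)%R < K)%N.
Proof.
case/matrix0Pn=> i [z]; rewrite (ord1 z) => ci.
exists ((c i 0)^-1 *: delta_mx 0 i).
have wc : (c i 0)^-1 *: delta_mx 0 i *m c = 1.
  rewrite -scalemxAl -rowE; apply/matrixP => x y.
  by rewrite (ord1 x) (ord1 y) !mxE eqxx mulVf.
split=> //; rewrite ltn_neqAle rank_leq_row andbT; apply: contra ci => fullN.
have /row_fullP[B] : row_full (1%:M - c *m ((c i 0)^-1 *: delta_mx 0 i)) by [].
move/(congr1 (mulmx^~ c)); rewrite mul1mx -mulmxA mulmxBl mul1mx -[c *m _ *m c]mulmxA wc.
by rewrite mulmx1 subrr mulmx0 => <-; rewrite mxE.
Qed.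

(** If [y = 0] or the columns of [L] are dependent, a column of [L] can be eliminated. Otherwise
    [isotropic_relation] gives [x^T y = 0], and a trivial motion turns the relation into one among
    the columns of [M] alone. *)
Lemma symprod_shrink n D K (P : 'M[F]_(n, D)) (L : 'M_(D, K)) (M : 'M_(n, K)) (x y : 'cV_K) :
  (2 * D <= n)%N -> free_config P -> unique_motion P (symprod (P *m L) M) ->
  P *m L *m x + M *m y = 0 -> col_mx x y != 0 ->
  exists K' (L' : 'M_(D, K')) (M' : 'M_(n, K')),
    (K' < K)%N /\ symprod (P *m L) M = symprod (P *m L') M'.
Proof.
move=> le2Dn freeP uniq rel xy0.
have /row_fullP[B BP] : row_full P by apply: free_config_full => //; lia.
have drop_col (c : 'cV_K) : c != 0 -> L *m c = 0 ->
    exists K' (L' : 'M_(D, K')) (M' : 'M_(n, K')),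
      (K' < K)%N /\ symprod (P *m L) M = symprod (P *m L') M'.
  move=> c0 Lc; have [w [wc rkN]] := annihilator_factor c0.
  have -> : L = L *m (1%:M - c *m w) by rewrite mulmxBr mulmx1 mulmxA Lc mul0mx subr0.
  exact: symprod_factor.
have [y0|y0] := eqVneq y 0.
  apply: (drop_col x); first by move: xy0; rewrite col_mx_eq0 y0 eqxx andbT.
  rewrite -[L]mul1mx -BP -!mulmxA (mulmxA P) -[P *m L *m x]addr0 -[0](mulmx0 _ M).
  by rewrite -{1}y0 rel mulmx0.
have [fullL|] := boolP (row_full L); last first.
  rewrite /row_full -mxrank_tr -/(row_free L^T) -kermx_eq0 => /rowV0Pn[v /sub_kermxP vL v0].
  apply: (drop_col v^T); first by rewrite trmx_eq0.
  by rewrite -[L]trmxK -trmx_mul vL trmx0.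
have [G GL] := row_fullP fullL.
pose b := G^T *m y; have Lb : L^T *m b = y by rewrite mulmxA -trmx_mul GL trmx1 mul1mx.
have Mb : M *m L^T *m b = P *m (- (L *m x)).
  by rewrite -mulmxA Lb mulmxN mulmxA; apply/eqP; rewrite -addr_eq0 addrC rel.
have b0 : b != 0 by apply: contraNneq y0 => b0; rewrite -Lb b0 mulmx0.
have xy : x^T *m y = 0.
  have uniq' : unique_motion P (symprod P (M *m L^T)) by rewrite -symprod_mulmxl.
  have := isotropic_relation le2Dn freeP uniq' Mb b0.
  by rewrite raddfN /= trmx_mul mulNmx -mulmxA Lb => /eqP; rewrite oppr_eq0 => /eqP.
have [w [wy rkN]] := annihilator_factor y0.
(* [A] is skew, and [w y = 1] with [x^T y = 0] gives [A y = x], so that [M1 y = M y + P L x = 0]. *)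
pose A := x *m w - w^T *m x^T.
have altA : A^T = - A by rewrite /A linearB /= !trmx_mul !trmxK opprB.
pose M1 := M + P *m L *m A.
have M1y : M1 *m y = 0.
  rewrite mulmxDl -[P *m L *m A *m y]mulmxA /A mulmxBl -!mulmxA xy mulmx0 subr0 wy mulmx1.
  by rewrite addrC mulmxA.
have -> : symprod (P *m L) M = symprod (P *m (L *m (1%:M - y *m w)^T)) M1.
  rewrite mulmxA [RHS]symprod_mulmxl trmxK mulmxBr mulmx1 [M1 *m _]mulmxA M1y mul0mx subr0.
  by rewrite symprodDr symprod_alt ?addr0.
by apply: symprod_factor; rewrite mxrank_tr.
Qed.


(** * Counting the zeros of a minimal motion in two ways *)

Definition zeros n (Q : 'M[F]_n) (a : 'I_n) : nat := #|[set b | Q a b == 0]|.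

Lemma mxvec_dot m n (A B : 'M[F]_(m, n)) : mxvec A *m (mxvec B)^T = (\tr (B^T *m A))%:M.
Proof.
apply/matrixP => x y; rewrite (ord1 x) (ord1 y) !mxE eqxx mulr1n.
rewrite (reindex _ (curry_mxvec_bij _ _)) /= /mxtrace.
under [RHS]eq_bigr => j _ do rewrite mxE.
rewrite exchange_big pair_bigA; apply: eq_bigr => [[i j]] /= _.
by rewrite !mxE !mxvecE mulrC.
Qed.

(** A nonzero determinant has a nonzero term in its Leibniz expansion. *)
Lemma unitmx_perm_support n (A : 'M[F]_n) : A \in unitmx ->
  exists s : 'S_n, forall i, A i (s i) != 0.
Proof.
rewrite unitmxE unitfE /determinant => dA.
have /existsP[s /forallP hs] : [exists s : 'S_n, [forall i, A i (s i) != 0]].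
  apply: contraNT dA; rewrite negb_exists => /forallP hs; rewrite big1 // => s _.
  have := hs s; rewrite negb_forall => /existsP[i]; rewrite negbK => /eqP Ai.
  by rewrite (bigD1 i) //= Ai mul0r mulr0.
by exists s.
Qed.

(** [symprod X M] is congruent, through [row_mx X M], to the hyperbolic form [B], which is its own
    inverse. *)
Lemma symprod_unit K (X M : 'M[F]_(K + K, K)) :
  row_mx X M \in unitmx -> symprod X M \in unitmx.
Proof.
move=> uW; pose B : 'M[F]_(K + K) := block_mx 0 1%:M 1%:M 0.
have BB : B *m B = 1%:M.
  by rewrite mulmx_block !mulmx0 !mul0mx !mulmx1 !addr0 !add0r -scalar_mx_block.
have -> : symprod X M = row_mx X M *m B *m (row_mx X M)^T.
  by rewrite mul_row_block !mulmx0 !mulmx1 addr0 add0r tr_row_mx mul_row_col addrC.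
by rewrite !unitmx_mul unitmx_tr uW (mulmx1_unit BB).1.
Qed.

Lemma big_codom_inj (V : Type) (idx : V) (op : Monoid.com_law idx) n k (j : 'I_k -> 'I_n)
    (f : 'I_n -> V) : injective j ->
  \big[op/idx]_(b in codom j) f b = \big[op/idx]_i f (j i).
Proof.
move=> injj; rewrite -big_uniq /=; first by rewrite big_image.
by rewrite map_inj_uniq ?enum_uniq.
Qed.

Lemma row_supported n k (W : 'M[F]_(n, k)) (j : 'I_k -> 'I_n) (v : 'rV_n) :
  injective j -> rowsub j W \in unitmx -> (forall b, b \notin codom j -> v 0 b = 0) ->
  v *m W = 0 -> v = 0.
Proof.
move=> injj uW hv vW; have vjW : colsub j v *m rowsub j W = 0.
  rewrite -[RHS]vW; apply/matrixP => x y; rewrite (ord1 x) !mxE.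
  rewrite [RHS](bigID (mem (codom j))) /= [X in _ + X]big1 ?addr0 => [|b /hv ->]; last first.
    by rewrite mul0r.
  by rewrite big_codom_inj //; apply: eq_bigr => i _; rewrite !mxE.
have vj : colsub j v = 0 by rewrite -[LHS]mulmx1 -(mulmxV uW) mulmxA vjW mul0mx.
apply/rowP => b; rewrite mxE; have [/codomP[i ->]|/hv //] := boolP (b \in codom j).
by move/rowP/(_ i): vj; rewrite !mxE.
Qed.

Section Count.
Variables (n D K : nat) (P : 'M[F]_(n, D)) (L : 'M[F]_(D, K)) (M : 'M[F]_(n, K)).
Let Q := symprod (P *m L) M.
Hypothesis freeP : free_config P.
Hypothesis Q0 : Q != 0.
Hypothesis diagQ : forall a, Q a a = 0.
Hypothesis zerosQ : forall a b, Q a b != 0 -> (n + 2 * D <= zeros Q a + zeros Q b + 2)%N.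
Hypothesis fullW : row_full (row_mx (P *m L) M).

Let j : 'I_(K + K) -> 'I_n := fullrankfun fullW.
Let injj : injective j. Proof. exact: fullrankfun_inj. Qed.

(* Each unordered pair meeting [J = codom j] on which [Q] vanishes is listed once. *)
Let T := [set t : 'I_n * 'I_n | [&& t.1 \in codom j, Q t.1 t.2 == 0 &
                                   (t.2 \notin codom j) || (t.1 <= t.2)%N]].

Lemma full_coefficients : row_full L.
Proof.
apply: full_cols => c Lc; have : row_mx (P *m L) M *m col_mx c 0 = 0.
  by rewrite mul_row_col mulmx0 addr0 -mulmxA Lc mulmx0.
case/row_fullP: fullW => B BW /(congr1 (mulmx B)); rewrite mulmxA BW mul1mx mulmx0.
by move/eqP; rewrite col_mx_eq0 => /andP[/eqP].
Qed.

Lemma rowsub_unit : rowsub j (row_mx (P *m L) M) \in unitmx.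
Proof. by rewrite -row_free_unit /row_free mxrank_fullrowsub. Qed.

Lemma symprod_symQ a b : Q a b = Q b a. Proof. exact: symprod_sym. Qed.

Lemma nonzero_transversal : exists s : 'S_(K + K), forall i, Q (j i) (j (s i)) != 0.
Proof.
have uW : row_mx (rowsub j (P *m L)) (rowsub j M) \in unitmx.
  have := rowsub_unit; congr (_ \in unitmx); apply/matrixP => x y.
  by rewrite !mxE; case: split => z; rewrite [RHS]mxE.
have [s hs] := unitmx_perm_support (symprod_unit uW); exists s => i.
have := hs i; congr (_ != 0); rewrite /Q !symprodE; apply: eq_bigr => l _.
by rewrite ![rowsub j _ _ _]mxE.
Qed.

(** Sum the zeros over the rows in [J]: each pair in [T] is counted once, and pairs inside [J] are
    counted a second time through [lower]. The hypothesis on the zeros, applied to [j x] and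
    [j (s x)] for every [x], bounds this sum from below. *)
Lemma card_zero_pairs_ge : (K * (n + 2 * D) <= #|T| + K * (2 * K))%N.
Proof.
have [s hs] := nonzero_transversal.
pose zero a b := Q a b == 0.
pose lower x y : nat := zero (j x) (j y) && (j y < j x)%N.
have zerosE x : zeros Q (j x) = (\sum_b (zero (j x) b && ((b \notin codom j) || (j x <= b)))
                                  + \sum_y lower x y)%N.
  rewrite -(big_codom_inj _ (fun b => (zero (j x) b && (b < j x)%N : nat))) //.
  rewrite /zeros -sum1dep_card big_mkcond [X in _ = (_ + X)%N]big_mkcond -big_split /=.
  apply: eq_bigr => b _.
  by rewrite /zero; case: eqP; case: (b \in codom j) => //=; rewrite ltnNge; case: leqP.
have TE : (#|T| + \sum_x \sum_y lower x y = \sum_x zeros Q (j x))%N.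
  under [RHS]eq_bigr => x _ do rewrite zerosE.
  rewrite big_split /=; congr (_ + _)%N.
  rewrite -(big_codom_inj _ (fun a => \sum_b
     (zero a b && ((b \notin codom j) || (a <= b)) : nat))%N) //.
  under eq_bigr => a _ do rewrite -big_mkcond.
  by rewrite pair_big_dep /= -sum1dep_card; apply: eq_bigl => -[a b].
(* For fixed [x], each [y] is charged at most once by [lower x y], [lower y x], [y == x] and
   [y == s x] together: the diagonal is not strictly ordered, [Q] is nonzero at [s x], and
   [s x != x] because the diagonal of [Q] vanishes. *)
have lowerE : (2 * (\sum_x \sum_y lower x y) + 2 * (K + K) <= (K + K) * (K + K))%N.
  rewrite mul2n -addnn {2}exchange_big /= -big_split /=.
  have -> : ((K + K) * (K + K) = \sum_(x < K + K) (K + K))%N by rewrite sum_nat_const card_ord.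
  have -> : (2 * (K + K) = \sum_(x < K + K) 2)%N by rewrite sum_nat_const card_ord mulnC.
  rewrite -big_split /=; apply: leq_sum => x _.
  have -> : (2 = \sum_y ((y == x) + (y == s x)))%N.
    by rewrite big_split /= -!big_mkcond !big_pred1_eq.
  have E : (\sum_(y < K + K) 1 = K + K)%N by rewrite sum_nat_const card_ord muln1.
  rewrite -[leqRHS]E -!big_split /=; apply: leq_sum => y _.
  rewrite /lower /zero [Q (j y) _]symprod_symQ.
  have [->|yx] := eqVneq y x.
    rewrite diagQ eqxx ltnn /=; have [xs|//] := eqVneq x (s x).
    by have := hs x; rewrite -xs diagQ eqxx.
  have [->|_] := eqVneq y (s x); first by rewrite (negPf (hs x)).
  by case: (_ == 0); case: ltngtP.
have degE : ((K + K) * (n + 2 * D) <= 2 * (\sum_x zeros Q (j x)) + 2 * (K + K))%N.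
  have -> : (2 * (\sum_x zeros Q (j x)) + 2 * (K + K) =
      \sum_(x < K + K) (zeros Q (j x) + zeros Q (j (s x)) + 2))%N.
    have R : (\sum_x zeros Q (j (s x)) = \sum_x zeros Q (j x))%N by rewrite [RHS](reindex_perm s).
    rewrite !big_split /= sum_nat_const card_ord R.
    by rewrite mul2n -addnn [(2 * _)%N]mulnC.
  rewrite -{1}[(K + K)%N]card_ord -sum_nat_const; apply: leq_sum => x _; exact: zerosQ.
nia.
Qed.

Let pair_mx (i : 'I_#|T|) : 'M[F]_n :=
  \matrix_(a, b) ((enum_val i == (a, b)) || (enum_val i == (b, a)))%:R.
Let comb (c : 'rV[F]_#|T|) : 'M[F]_n := \sum_i c 0 i *: pair_mx i.

Lemma pair_mx_sym i : (pair_mx i)^T = pair_mx i.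
Proof. by apply/matrixP => a b; rewrite !mxE orbC. Qed.

Lemma pair_mx_avoids i : avoids Q (pair_mx i).
Proof.
move=> a b Qab; rewrite mxE; have := enum_valP i; rewrite inE => /and3P[_ Q0i _].
move: Q0i; have [->|_] := eqVneq (enum_val i) (a, b); first by rewrite (negPf Qab).
by have [->|//] := eqVneq (enum_val i) (b, a); rewrite symprod_symQ (negPf Qab).
Qed.

Lemma comb_sym c : (comb c)^T = comb c.
Proof. by rewrite linear_sum; apply: eq_bigr => i _; rewrite linearZ /= pair_mx_sym. Qed.

Lemma comb_avoids c : avoids Q (comb c).
Proof.
move=> a b Qab; rewrite summxE big1 // => i _.
by rewrite mxE pair_mx_avoids ?mulr0.
Qed.

Lemma comb_support c a b : a \notin codom j -> b \notin codom j -> comb c a b = 0.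
Proof.
move=> aj bj; rewrite summxE big1 // => i _; rewrite !mxE.
have := enum_valP i; rewrite inE => /andP[tj _].
move: tj; have [->|_] := eqVneq (enum_val i) (a, b); first by rewrite (negPf aj).
by have [->|_ _] := eqVneq (enum_val i) (b, a); rewrite ?(negPf bj) // mulr0.
Qed.

(** Distinct pairs in [T] are never reverses of each other: both ends would lie in [J], and the
    order condition would make them equal. So each coefficient is an entry of [comb c]. *)
Lemma comb_inj c : comb c = 0 -> c = 0.
Proof.
move=> c0; apply/rowP => i; rewrite [RHS]mxE.
move/matrixP/(_ (enum_val i).1 (enum_val i).2): c0; rewrite summxE [RHS]mxE.
rewrite (bigD1 i) //= big1 ?addr0 => [|k ki].
  by rewrite !mxE -surjective_pairing eqxx mulr1.
rewrite !mxE -surjective_pairing (inj_eq enum_val_inj) (negPf ki) /=.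
case: eqP => [E|_]; last by rewrite mulr0.
have := enum_valP k; have := enum_valP i; rewrite E !inE /=.
case/and3P=> j1 _ le1; case/and3P=> j2 _ le2; case/negP: ki; apply/eqP/enum_val_inj.
rewrite E [RHS]surjective_pairing; move: le1 le2; rewrite j1 j2 /= => le1 le2.
have -> // : (enum_val i).1 = (enum_val i).2 by apply: val_inj; apply: anti_leq; rewrite le1 le2.
Qed.

(** [comb c] kills both [P L] and [M]. A row outside [J] is supported on [J], where [row_mx (P L) M]
    is invertible, so it vanishes; by symmetry every row is then supported on [J] and vanishes
    too. *)
Lemma comb_stress c r (C : 'M_(D, r)) :
  (forall V : 'M_(D, K), exists a t, V = L *m a + C *m t) ->
  comb c *m (P *m L) = 0 -> (P *m C)^T *m (comb c *m M) = 0 -> c = 0.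
Proof.
move=> hC WX WZ; apply: comb_inj.
have WM := stress_kills_motion freeP full_coefficients hC (comb_sym c) (@comb_avoids c) WX WZ.
have WW : comb c *m row_mx (P *m L) M = 0 by rewrite mul_mx_row WX WM row_mx0.
have row0 a : (forall b, b \notin codom j -> comb c a b = 0) -> forall b, comb c a b = 0.
  move=> ha b; have := row_supported (v := row a (comb c)) injj rowsub_unit.
  move=> /(_ _ _)/rowP/(_ b); rewrite !mxE; apply; first by move=> b' /ha; rewrite mxE.
  by rewrite -row_mul WW row0.
have outer a : a \notin codom j -> forall b, comb c a b = 0.
  by move=> aj; apply: row0 => b bj; exact: comb_support.
apply/matrixP => a b; rewrite [RHS]mxE; apply: row0 => {}b bj.
by rewrite -comb_sym mxE outer.
Qed.

(** [Psi] records the linear conditions of [comb_stress], so it is injective. The inequality is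
    strict because its image is orthogonal to the nonzero vector [(M, 0)]: pairing [Q] with a matrix
    supported on its zeros gives [0]. *)
Lemma card_zero_pairs_lt : exists2 r, (r + K = D)%N & (#|T| < n * K + r * K)%N.
Proof.
have [r [C [rK hC]]] := col_complement full_coefficients; exists r => //.
pose Psi : 'M[F]_(#|T|, n * K + r * K) := \matrix_i
  row_mx (mxvec (pair_mx i *m (P *m L))) (mxvec ((P *m C)^T *m (pair_mx i *m M))).
have PsiE c : c *m Psi =
    row_mx (mxvec (comb c *m (P *m L))) (mxvec ((P *m C)^T *m (comb c *m M))).
  rewrite mulmx_sum_row /comb !mulmx_suml mulmx_sumr !linear_sum /=.
  rewrite -[RHS]/(row_mx _ _); apply/rowP => z; rewrite summxE [RHS]mxE.
  case: split_ordP => y ->; rewrite summxE; apply: eq_bigr => i _;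
    rewrite [in LHS]mxE rowK ?row_mxEl ?row_mxEr.
  - by rewrite -scalemxAl linearZ /= mxE.
  - by rewrite -scalemxAl -scalemxAr linearZ /= mxE.
have freePsi : row_free Psi.
  rewrite -kermx_eq0; apply/eqP/row_matrixP => i; rewrite row0.
  have /eqP : row i (kermx Psi) *m Psi = 0 by rewrite -row_mul mulmx_ker row0.
  rewrite PsiE row_mx_eq0 !mxvec_eq0 => /andP[/eqP WX /eqP WZ].
  exact: comb_stress hC WX WZ.
rewrite -(eqP freePsi) ltn_neqAle rank_leq_col andbT; apply/negP => fullPsi.
have /row_fullP[B BPsi] : row_full Psi by [].
have M0 : M != 0 by apply: contraNneq Q0 => M0; rewrite /Q M0 /symprod trmx0 mulmx0 mul0mx addr0.
have : Psi *m col_mx (mxvec M)^T 0 = 0.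
  apply/row_matrixP => i; rewrite row_mul rowK mul_row_col mulmx0 addr0 row0 mxvec_dot mulmxA.
  have /eqP := mxtrace_avoids (pair_mx_sym i) (fun a b => id) (@pair_mx_avoids i).
  rewrite /Q mxtrace_symprod ?pair_mx_sym // -mulr_natr mulf_eq0 (negPf char2) orbF => /eqP ->.
  exact: raddf0.
move/(congr1 (mulmx B)); rewrite mulmxA BPsi mul1mx mulmx0 => /eqP.
by rewrite col_mx_eq0 trmx_eq0 mxvec_eq0 (negPf M0).
Qed.

Lemma count_contradiction : False.
Proof.
have [r rK up] := card_zero_pairs_lt; have lo := card_zero_pairs_ge.
have K0 : (0 < K)%N.
  case: (posnP K) up => // ->; rewrite !muln0; lia.
(* With [r = D - K] the bounds read [n K + 2 r K <= #|T| < n K + r K]. *)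
nia.
Qed.

End Count.

(** Descent on [K]: either [row_mx (P L) M] has independent columns and the count applies, or a
    relation among them yields a factorization with fewer columns. *)
Lemma no_unique_motion n D (P : 'M[F]_(n, D)) (Q : 'M_n) :
  (2 * D <= n)%N -> free_config P -> unique_motion P Q -> Q != 0 -> (forall a, Q a a = 0) ->
  (forall a b, Q a b != 0 -> (n + 2 * D <= zeros Q a + zeros Q b + 2)%N) ->
  forall K (L : 'M_(D, K)) (M : 'M_(n, K)), Q <> symprod (P *m L) M.
Proof.
move=> le2Dn freeP uniq Q0 diagQ zerosQ; elim/ltn_ind=> K IH L M EQ.
rewrite {}EQ in uniq Q0 diagQ zerosQ IH.
have [fullW|] := boolP (row_full (row_mx (P *m L) M)).
  exact: (count_contradiction freeP Q0 diagQ zerosQ fullW).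
rewrite /row_full -mxrank_tr -/(row_free _) -kermx_eq0 => /rowV0Pn[v /sub_kermxP vW v0].
have := @symprod_shrink _ _ _ P L M (usubmx v^T) (dsubmx v^T) le2Dn freeP uniq.
case; last by move=> K' [L' [M' [ltK E]]]; exact: IH ltK _ _ E.
  by rewrite -mul_row_col vsubmxK -[row_mx _ _]trmxK -trmx_mul vW trmx0.
by rewrite vsubmxK trmx_eq0.
Qed.

Theorem free_config_rigid n D (P : 'M[F]_(n, D)) (e : rel 'I_n) :
  free_config P -> irreflexive e ->
  (forall u v, u != v -> ~~ e u v ->
     (n + 2 * D <= #|[set w | e u w]| + #|[set w | e v w]| + 4)%N) ->
  forall N, (forall a b, (a == b) || e a b -> symprod P N a b = 0) -> symprod P N = 0.
Proof.
move=> freeP irr ore N; move E: #|[set p | symprod P N p.1 p.2 != 0]| => s.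
elim/ltn_ind: s N E => s IH N Es hN; apply/eqP/negPn/negP => Q0.
have hz a b : symprod P N a b != 0 -> a != b /\ ~~ e a b.
  by move=> Qab; split; apply: contraNN Qab => h; rewrite hN ?h ?orbT.
have zge a : (#|[set w | e a w]| < zeros (symprod P N) a)%N.
  have -> : #|[set w | e a w]|.+1 = #|a |: [set w | e a w]| by rewrite cardsU1 inE irr.
  apply/subset_leq_card/subsetP => w; rewrite !inE => /orP[/eqP->|eaw].
    by rewrite hN ?eqxx.
  by rewrite hN ?eaw ?orbT.
have zerosQ a b : symprod P N a b != 0 ->
    (n + 2 * D <= zeros (symprod P N) a + zeros (symprod P N) b + 2)%N.
  by move=> /hz[ab eab]; have := ore a b ab eab; have := zge a; have := zge b; lia.
case/matrix0Pn: (Q0) => u [v Quv].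
have zlt a b : symprod P N a b != 0 -> (zeros (symprod P N) a < n)%N.
  move=> Qab; rewrite -[ltnRHS]card_ord -cardsT; apply: proper_card; rewrite properT.
  by apply: contraNneq Qab => eT; have := in_setT b; rewrite -eT inE.
(* Rows [u] and [v] each have at most [n - 1] zeros, so [zerosQ] gives [n + 2 D <= 2 n]. *)
have le2Dn : (2 * D <= n)%N.
  have Qvu : symprod P N v u != 0 by rewrite symprod_sym.
  by have := zerosQ u v Quv; have := zlt _ _ Quv; have := zlt _ _ Qvu; lia.
apply: (@no_unique_motion _ _ P (symprod P N) le2Dn freeP _ Q0 _ zerosQ D 1%:M N);
  last by rewrite mulmx1.
  move=> N' zN'; exists (symprod P N' u v / symprod P N u v).
  (* The multiple of [N] is chosen to cancel the entry at [(u, v)]; the support shrinks strictly, so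
     induction makes the difference zero. *)
  pose N2 := N' - (symprod P N' u v / symprod P N u v) *: N.
  have E2 a b : symprod P N2 a b =
      symprod P N' a b - symprod P N' u v / symprod P N u v * symprod P N a b.
    by rewrite /N2 symprodBr symprodZr; move: (symprod P N) (symprod P N') => S S'; rewrite !mxE.
  have z2 a b : symprod P N a b = 0 -> symprod P N2 a b = 0.
    by move=> Q_0; rewrite E2 Q_0 zN' // mulr0 subr0.
  suff N20 : symprod P N2 = 0.
    apply/matrixP => a b; have /matrixP/(_ a b) := N20; rewrite E2 [X in _ = X -> _]mxE => /eqP.
    by rewrite subr_eq0 [RHS]mxE => /eqP.
  apply: (IH _ _ N2 erefl); last first.
    by move=> a b /hN; exact: z2.
  rewrite -Es; apply: proper_card; apply/properP; split.
    by apply/subsetP => -[a b]; rewrite !inE /=; apply: contraNN => /eqP/z2->.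
  exists (u, v); rewrite !inE ?Quv //= negbK E2 divfK //.
  by rewrite subrr.
by move=> a; rewrite hN ?eqxx.
Qed.

End LinearMotions.

(** * The generic configuration *)

Local Notation "x %:F" := (tofrac x).

(** The boolean form lets [xchoose] select a numerator and a denominator. *)
Lemma frac_numden (A : idomainType) (f : {fraction A}) :
  exists p : A * A, (p.2 != 0) && (f * p.2%:F == p.1%:F).
Proof.
elim/quotW: f => x; exists (frac x); rewrite denom_ratioP /=; apply/eqP.
rewrite !piE; apply/eqmodP; rewrite /= FracField.equivfE /FracField.mulf.
by rewrite !numden_Ratio ?mulr1 ?oner_neq0 ?denom_ratioP // mulrC.
Qed.

Lemma frac_derivation (A : idomainType) (d0 : A -> {fraction A}) :
  {morph d0 : x y / x + y} -> (forall x y, d0 (x * y) = d0 x * y%:F + x%:F * d0 y) ->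
  exists2 delta, derivation delta & forall x, delta x%:F = d0 x.
Proof.
move=> dD dM.
pose num (f : {fraction A}) := (xchoose (frac_numden f)).1.
pose den (f : {fraction A}) := (xchoose (frac_numden f)).2.
have den0 f : den f != 0 by case/andP: (xchooseP (frac_numden f)).
have Fden0 f : (den f)%:F != 0 by rewrite tofrac_eq0.
have numE f : (num f)%:F = f * (den f)%:F.
  by case/andP: (xchooseP (frac_numden f)) => _ /eqP.
clearbody num den.
pose delta f := (d0 (num f) - f * d0 (den f)) / (den f)%:F.
(* The quotient rule is independent of the representative: differentiate the cross-multiplied
   identity [num f * b = a * den f]. *)
have deltaE f a b : b != 0 -> a%:F = f * b%:F -> delta f * b%:F = d0 a - f * d0 b.
  move=> b0 fb; have /(congr1 d0) : num f * b = a * den f.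
    by apply/eqP; rewrite -tofrac_eq !tofracM fb numE mulrAC.
  rewrite !dM fb numE => E; apply: (mulIf (Fden0 f)).
  rewrite /delta mulrAC divfK //; apply/eqP; rewrite -subr_eq0; apply/eqP.
  by rewrite -[RHS](subrr (d0 a * (den f)%:F + f * b%:F * d0 (den f))) -{1}E; ring.
exists delta; last first.
  move=> x; have d01 : d0 1 = 0.
    by apply: (addIr (d0 1)); rewrite add0r -{3}[1]mulr1 dM tofrac1 mulr1 mul1r.
  have := @deltaE x%:F x 1 (oner_neq0 _); rewrite tofrac1 !mulr1 d01 mulr0 subr0; exact.
have dd f g : den f * den g != 0 by rewrite mulf_neq0.
split=> [f g|f g]; apply: (mulIf (mulf_neq0 (Fden0 f) (Fden0 g))); rewrite -tofracM.
- rewrite (@deltaE _ (num f * den g + num g * den f)) //; last first.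
    by rewrite tofracD !tofracM !numE; ring.
  rewrite !(dD, dM) tofracM !numE.
  rewrite [(delta f + _) * _](_ : _ = delta f * (den f)%:F * (den g)%:F
    + delta g * (den g)%:F * (den f)%:F); last by ring.
  by rewrite (deltaE f (num f)) // (deltaE g (num g)) //; ring.
- rewrite (@deltaE _ (num f * num g)) //; last by rewrite !tofracM !numE; ring.
  rewrite !(dD, dM) tofracM !numE [in RHS]mulrDl.
  rewrite [delta f * _ * _](_ : _ = delta f * (den f)%:F * (g * (den g)%:F)); last by ring.
  rewrite [f * delta g * _](_ : _ = delta g * (den g)%:F * (f * (den f)%:F)); last by ring.
  by rewrite (deltaE f (num f)) // (deltaE g (num g)) //; ring.
Qed.

Lemma mderivX1 (N : nat) (R : nzRingType) (i c : 'I_N) : 'X_i^`M(c) = (i == c)%:R :> {mpoly R[N]}.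
Proof.
rewrite mderivX mnm1E; case: eqP => [->|_]; last by rewrite scale0r.
rewrite scale1r (_ : (U_(c) - U_(c) = 0)%MM) ?mpolyX0 //.
by apply/mnmP => k; rewrite mnmBE subnn mnm0E.
Qed.

Section Generic.
Variables n d : nat.
Definition generic_field := {fraction {mpoly rat[n * d]}}.

Definition variable_mx (T : comNzRingType) : 'M[{mpoly T[n * d]}]_(n, d) := vec_mx (\row_c 'X_c).
Definition generic_config : 'M[generic_field]_(n, d + 1) :=
  row_mx (map_mx (@tofrac _) (variable_mx rat)) (const_mx 1).

(** The constant last column forces [sigma], since its twisted derivative is [sigma] itself. The
    other columns are variables, whose derivatives can be prescribed to correct for [sigma]. *)
Lemma generic_config_free : free_config generic_config.
Proof.
move=> Y; pose sigma a := Y a (rshift d 0).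
pose u : 'rV[generic_field]_(n * d) := mxvec (\matrix_(a, i)
   (Y a (lshift 1 i) - sigma a * (variable_mx rat a i)%:F)).
pose d0 (p : {mpoly rat[n * d]}) := \sum_c u 0 c * (p^`M(c))%:F.
have [|p q|delta hd deltaE] := @frac_derivation _ d0.
- by move=> p q; rewrite /d0 -big_split; apply: eq_bigr => c _; rewrite mderivD tofracD mulrDr.
- rewrite /d0 mulr_suml mulr_sumr -big_split; apply: eq_bigr => c _.
  by rewrite mderivM tofracD !tofracM /=; ring.
exists delta, sigma; split=> //; apply/matrixP => a i; rewrite mxE /generic_config.
case: (split_ordP i) => k ->; rewrite ?row_mxEl ?row_mxEr !mxE; last first.
  rewrite (ord1 k) -tofrac1 deltaE /d0 big1 ?add0r ?mulr1 // => c _.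
  by rewrite mderivC tofrac0 mulr0.
rewrite deltaE /d0 (bigD1 (mxvec_index a k)) //= big1 ?addr0 => [|c ck].
  by rewrite mderivX1 eqxx tofrac1 mulr1 /u mxvecE !mxE subrK.
by rewrite mderivX1 eq_sym (negPf ck) tofrac0 mulr0.
Qed.
End Generic.

(** * Rigidity matrices *)

Definition complete (n : nat) : rel 'I_n := fun _ _ => true.

Section RigidityMatrix.
Variables (T : comNzRingType) (n d : nat).

(** Half the derivative of the squared edge lengths at [p] in the direction [m]; its kernel consists
    of the infinitesimal motions. *)
Definition rigidity_map (e : rel 'I_n) (p m : 'M[T]_(n, d)) : 'M[T]_n :=
  \matrix_(a, b) if e a b then \sum_i (p a i - p b i) * (m a i - m b i) else 0.

Lemma rigidity_map_is_linear e p : linear (rigidity_map e p).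
Proof.
move=> c x y; apply/matrixP => a b; rewrite !mxE; case: ifP => _; last by rewrite mulr0 addr0.
by rewrite mulr_sumr -big_split; apply: eq_bigr => i _; rewrite !mxE /=; ring.
Qed.
HB.instance Definition _ e p :=
  GRing.isLinear.Build T 'M[T]_(n, d) 'M[T]_n _ (rigidity_map e p) (rigidity_map_is_linear e p).

Definition rigidity_mx e p : 'M[T]_(n * d, n * n) := lin_mx (rigidity_map e p).

End RigidityMatrix.

Lemma map_rigidity_mx (T T' : comNzRingType) (f : {rmorphism T -> T'}) n d e (p : 'M[T]_(n, d)) :
  map_mx f (rigidity_mx e p) = rigidity_mx e (map_mx f p).
Proof.
apply: map_lin_mx => m; apply/matrixP => a b; rewrite !mxE; case: ifP => _; last exact: rmorph0.
by rewrite rmorph_sum; apply: eq_bigr => i _; rewrite !mxE rmorphM !rmorphB.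
Qed.

(** * Kernels, minors and specialization of ranks *)

Section Ranks.
Variables (F : fieldType) (n d : nat).
Implicit Types p m : 'M[F]_(n, d).

Lemma rigidity_map_eq0 e p m : (rigidity_map e p m == 0) = (mxvec m *m rigidity_mx e p == 0).
Proof. by rewrite mul_vec_lin mxvec_eq0. Qed.

Lemma rank_rigidity_le e e' p :
  (forall m, rigidity_map e p m = 0 -> rigidity_map e' p m = 0) ->
  (\rank (rigidity_mx e' p) <= \rank (rigidity_mx e p))%N.
Proof.
move=> h; have : (kermx (rigidity_mx e p) <= kermx (rigidity_mx e' p))%MS.
  apply/row_subP => i; apply/sub_kermxP; rewrite -[row i _]vec_mxK; apply/eqP.
  rewrite -rigidity_map_eq0; apply/eqP/h/eqP.
  rewrite rigidity_map_eq0 vec_mxK -row_mul mulmx_ker row0.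
  exact: eqxx.
move/mxrankS; rewrite !mxrank_ker => hr.
by have := rank_leq_row (rigidity_mx e p); have := rank_leq_row (rigidity_mx e' p); lia.
Qed.

(** Motions of the complete graph are always motions of [e]; the rank inequality makes the two
    kernels equal. *)
Lemma rigidity_map_complete e p m :
  (\rank (rigidity_mx (@complete n) p) <= \rank (rigidity_mx e p))%N ->
  rigidity_map e p m = 0 -> rigidity_map (@complete n) p m = 0.
Proof.
move=> hr rm; have sub : (kermx (rigidity_mx (@complete n) p) <= kermx (rigidity_mx e p))%MS.
  apply/row_subP => i; apply/sub_kermxP; rewrite -[row i _]vec_mxK; apply/eqP.
  rewrite -rigidity_map_eq0.
  have /eqP : row i (kermx (rigidity_mx (@complete n) p)) *m rigidity_mx (@complete n) p = 0.
    by rewrite -row_mul mulmx_ker row0.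
  rewrite -[row i _]vec_mxK -rigidity_map_eq0 vec_mxK => /eqP/matrixP h; apply/eqP/matrixP => a b.
  by rewrite !mxE; case: ifP => // _; have := h a b; rewrite !mxE.
have /eqP rig0 : rigidity_map e p m == 0 by rewrite rm.
apply/eqP; rewrite rigidity_map_eq0; apply/eqP/sub_kermxP.
have sub_m : (mxvec m <= kermx (rigidity_mx e p))%MS.
  by apply/sub_kermxP/eqP; rewrite -rigidity_map_eq0 rig0.
apply: submx_trans sub_m _; rewrite -(mxrank_leqif_sup sub) eqn_leq mxrankS //= !mxrank_ker.
by rewrite leq_sub2l.
Qed.

Lemma minor_ex s t (A : 'M[F]_(s, t)) :
  exists (f : 'I_(\rank A) -> 'I_s) (g : 'I_(\rank A) -> 'I_t), \det (mxsub f g A) != 0.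
Proof.
have fA : row_full (rowsub (maxrankfun A) A)^T.
  by rewrite /row_full mxrank_tr eq_maxrowsub.
exists (maxrankfun A), (fullrankfun fA); rewrite -unitfE -unitmxE.
have := fullrowsub_unit fA; rewrite -unitmx_tr; congr (_ \in unitmx).
by apply/matrixP => i k; rewrite !mxE.
Qed.

Lemma minor_rank s t r (A : 'M[F]_(s, t)) (f : 'I_r -> 'I_s) (g : 'I_r -> 'I_t) :
  \det (mxsub f g A) != 0 -> (r <= \rank A)%N.
Proof.
rewrite -unitfE -unitmxE -row_free_unit => /eqP {1}<-.
have -> : mxsub f g A = rowsub f 1%:M *m A *m colsub g 1%:M.
  by rewrite mul_rowsub_mx mul1mx mulmx_colsub mulmx1; apply/matrixP => i k; rewrite !mxE.
exact: leq_trans (mxrankM_maxl _ _) (mxrankM_maxr _ _).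
Qed.
End Ranks.

(** A nonzero maximal minor over [K] comes from a minor over [A], and stays nonzero under [g]. *)
Lemma map_rank_le (A : comNzRingType) (K R : fieldType) (f : {rmorphism A -> K})
    (g : {rmorphism A -> R}) s t (M : 'M[A]_(s, t)) :
  (forall x, f x != 0 -> g x != 0) -> (\rank (map_mx f M) <= \rank (map_mx g M))%N.
Proof.
move=> fg; have [u [v]] := minor_ex (map_mx f M).
by rewrite -map_mxsub det_map_mx => /fg; rewrite -det_map_mx map_mxsub; exact: minor_rank.
Qed.

(** * From the field of rational functions to real configurations *)

Section Generic.
Variables (R : realType) (n d : nat).

Definition eval_at (q : 'M[R]_(n, d)) : {mpoly rat[n * d]} -> R :=
  mmap (ratr : rat -> R) (fun k => mxvec q 0 k).
HB.instance Definition _ q := GRing.RMorphism.on (eval_at q).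

Lemma eval_at_variable_mx q : map_mx (eval_at q) (variable_mx n d rat) = q.
Proof. by apply/matrixP => a i; rewrite !mxE /eval_at mmapX mmap1U mxvecE. Qed.

Lemma generic_config_rank (e : rel 'I_n) : (0 < n)%N -> (0 < d)%N -> irreflexive e ->
  eta_ge e (n + 3 * d - 3) ->
  (\rank (rigidity_mx (@complete n) (map_mx (@tofrac _) (variable_mx n d rat))) <=
   \rank (rigidity_mx e (map_mx (@tofrac _) (variable_mx n d rat))))%N.
Proof.
move=> n0 d0 irr ore; apply: rank_rigidity_le => m rm.
set x : 'M[generic_field n d]_(n, d) := map_mx _ _ in rm *.
(* The coned coordinate [phi] is the one making the diagonal of [symprod] vanish; the other entries
   then become those of the rigidity map up to sign. *)
pose phi : 'M[generic_field n d]_(n, 1) := \matrix_(a, _) - \sum_i x a i * m a i.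
have symE a b : symprod (generic_config n d) (row_mx m phi) a b =
    - \sum_i (x a i - x b i) * (m a i - m b i).
  rewrite symprodE big_split_ord big_ord1 /= !row_mxEr ![const_mx _ _ _]mxE ![phi _ _]mxE.
  rewrite -!sumrN mulr1 mul1r -!big_split /=; apply: eq_bigr => i _.
  by rewrite !row_mxEl -/x; ring.
have char2 : 2 != 0 :> generic_field n d.
  rewrite -(rmorph_nat (@tofrac {mpoly rat[n * d]})) tofrac_eq0.
  by rewrite -(rmorph_nat (@mpolyC (n * d) rat)) mpolyC_eq0.
have S0 : symprod (generic_config n d) (row_mx m phi) = 0.
  have rigid := free_config_rigid char2 (@generic_config_free n d) irr.
  apply: rigid => [u v uv euv|a b].
    (* With [D = d + 1] the goal amounts to [n + 2 d - 2 <= deg e u + deg e v], which follows from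
       [n + 3 d - 3] as [d >= 1]. *)
    by have := ore u v uv euv; rewrite /deg; lia.
  rewrite symE => /orP[/eqP->|eab].
    by rewrite big1 ?oppr0 // => i _; rewrite subrr mul0r.
  by move/matrixP/(_ a b): rm; rewrite !mxE eab => ->; rewrite oppr0.
apply/matrixP => a b; move/matrixP/(_ a b): S0; rewrite symE !mxE /=.
by move/eqP; rewrite oppr_eq0 => /eqP.
Qed.

(** Specializing the variables to [q] cannot raise the rank, specializing them to the generic [P]
    does not lower it, and over the rational functions [generic_config_rank] compares the two
    graphs. *)
Lemma generic_max_rank (e : rel 'I_n) (P q : 'M[R]_(n, d)) :
  (0 < n)%N -> (0 < d)%N -> irreflexive e -> eta_ge e (n + 3 * d - 3) -> generic P ->
  (\rank (rigidity_mx (@complete n) q) <= \rank (rigidity_mx e P))%N.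
Proof.
move=> n0 d0 irr ore genP.
rewrite -(eval_at_variable_mx q) -(eval_at_variable_mx P) -!map_rigidity_mx.
apply: (@leq_trans (\rank (map_mx (@tofrac _) (rigidity_mx (@complete n) (variable_mx n d rat))))).
  by apply: map_rank_le => x; rewrite tofrac_eq0; apply: contraNN => /eqP->; rewrite rmorph0.
apply: leq_trans (_ : \rank (map_mx (@tofrac _) (rigidity_mx e (variable_mx n d rat))) <= _)%N.
  by rewrite !map_rigidity_mx; exact: generic_config_rank.
by apply: map_rank_le => x; rewrite tofrac_eq0; exact: genP.
Qed.
End Generic.

(** * Continuous motions *)

Section Continuity.
Variables (R : realType) (t : R).

Definition cont_at (h : R -> R) := forall eps, 0 < eps ->
  exists2 delta, 0 < delta & forall s, 0 <= s <= 1 -> `|s - t| < delta -> `|h s - h t| < eps.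

Lemma cont_at_cst c : cont_at (fun _ => c).
Proof. by move=> eps e0; exists 1 => // s _ _; rewrite subrr normr0. Qed.

Lemma cont_atD g h : cont_at g -> cont_at h -> cont_at (fun s => g s + h s).
Proof.
move=> cg ch eps e0; have e2 : 0 < eps / 2 by rewrite divr_gt0.
have [d1 d10 h1] := cg _ e2; have [d2 d20 h2] := ch _ e2.
exists (Num.min d1 d2) => [|s s01]; first by rewrite lt_min d10.
rewrite lt_min => /andP[/(h1 s s01) b1 /(h2 s s01) b2].
rewrite opprD addrACA (le_lt_trans (ler_normD _ _)) // [ltRHS](splitr eps).
exact: ltrD.
Qed.

Lemma cont_atM g h : cont_at g -> cont_at h -> cont_at (fun s => g s * h s).
Proof.
move=> cg ch eps e0; pose B := `|g t| + `|h t| + 1.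
have B0 : 0 < B by rewrite /B ltr_pwDr // addr_ge0.
have e2 : 0 < Num.min 1 (eps / (2 * B)) by rewrite lt_min ltr01 divr_gt0 // mulr_gt0.
have [d1 d10 h1] := cg _ e2; have [d2 d20 h2] := ch _ e2.
exists (Num.min d1 d2) => [|s s01]; first by rewrite lt_min d10.
rewrite lt_min => /andP[/(h1 s s01) b1 /(h2 s s01)].
move: b1; rewrite !lt_min ltr_pdivlMr ?mulr_gt0 // => /andP[_ b1].
rewrite ltr_pdivlMr ?mulr_gt0 // => /andP[b2' b2].
have -> : g s * h s - g t * h t = (g s - g t) * h s + g t * (h s - h t) by ring.
apply: le_lt_trans (ler_normD _ _) _; rewrite !normrM.
have hs : `|h s| <= `|h t| + 1.
  by rewrite -[h s](subrK (h t)) (le_trans (ler_normD _ _)) //; lra.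
have := normr_ge0 (g s - g t); have := normr_ge0 (h s - h t).
have := normr_ge0 (g t); have := normr_ge0 (h t); rewrite /B in b1 b2 *; nra.
Qed.

Lemma cont_at_sum I (r : seq I) (P : pred I) (g : I -> R -> R) :
  (forall i, cont_at (g i)) -> cont_at (fun s => \sum_(i <- r | P i) g i s).
Proof.
move=> cg; elim: r => [|i r IH].
  move=> eps /(cont_at_cst 0)[delta d0 h]; exists delta => // s s01 /(h s s01).
  by rewrite !big_nil.
have [Pi|nPi] := boolP (P i); last first.
  move=> eps /IH[delta d0 h]; exists delta => // s s01 /(h s s01).
  by rewrite !big_cons (negPf nPi).
move=> eps /(cont_atD (cg i) IH)[delta d0 h]; exists delta => // s s01 /(h s s01).
by rewrite !big_cons Pi.
Qed.

Lemma cont_at_prod I (r : seq I) (P : pred I) (g : I -> R -> R) :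
  (forall i, cont_at (g i)) -> cont_at (fun s => \prod_(i <- r | P i) g i s).
Proof.
move=> cg; elim: r => [|i r IH].
  move=> eps /(cont_at_cst 1)[delta d0 h]; exists delta => // s s01 /(h s s01).
  by rewrite !big_nil.
have [Pi|nPi] := boolP (P i); last first.
  move=> eps /IH[delta d0 h]; exists delta => // s s01 /(h s s01).
  by rewrite !big_cons (negPf nPi).
move=> eps /(cont_atM (cg i) IH)[delta d0 h]; exists delta => // s s01 /(h s s01).
by rewrite !big_cons Pi.
Qed.

Lemma cont_at_eq g h : g =1 h -> cont_at g -> cont_at h.
Proof.
by move=> gh cg eps /cg[delta d0 k]; exists delta => // s s01 /(k s s01); rewrite !gh.
Qed.

Lemma cont_at_det k (A : R -> 'M[R]_k) :
  (forall i j, cont_at (fun s => A s i j)) -> cont_at (fun s => \det (A s)).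
Proof.
move=> cA; apply: cont_at_sum => s; apply: cont_atM; first exact: cont_at_cst.
by apply: cont_at_prod => i; exact: cA.
Qed.

Lemma cont_at_neq0 h : cont_at h -> h t != 0 -> exists2 delta, 0 < delta &
  forall s, 0 <= s <= 1 -> `|s - t| < delta -> h s != 0.
Proof.
move=> ch ht; have [|delta d0 hd] := ch `|h t|; first by rewrite normr_gt0.
exists delta => // s s01 /(hd s s01); apply: contraTneq => ->.
by rewrite sub0r normrN ltxx.
Qed.

End Continuity.

(** Connectedness of the unit interval, by the supremum [c] of the [t] such that [good] holds on all
    of [[0, t]]. *)
Lemma locally_constant01 (R : realType) (good : R -> bool) : good 0 ->
  (forall t, 0 <= t <= 1 -> exists2 delta, 0 < delta &
     forall s, 0 <= s <= 1 -> `|s - t| < delta -> good s = good t) ->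
  forall t, 0 <= t <= 1 -> good t.
Proof.
move=> good0 loc.
pose S : set R := [set t | 0 <= t <= 1 /\ forall s, 0 <= s <= t -> good s]%classic.
have S0 : S 0.
  by split=> [|s s0]; [rewrite lexx ler01 | rewrite (_ : s = 0) //; apply/eqP; rewrite eq_le andbC].
have supS : has_sup S by split; [exists 0 | exists 1 => t [/andP[]]].
pose c := sup S.
have c0 : 0 <= c by apply: ub_le_sup => //; case: supS.
have c1 : c <= 1 by apply: ge_sup; [exists 0 | move=> t [/andP[]]].
have [|delta d0 hd] := loc c; first by rewrite c0.
have [t [t01 ht] tc] := sup_adherent d0 supS.
have lec : t <= c by apply: ub_le_sup => //; case: supS.
have goodc : good c.
  rewrite -(hd t t01); first by apply: ht; rewrite lexx andbT; case/andP: t01.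
  by rewrite distrC ger0_norm ?subr_ge0 // ltrBlDl -ltrBlDr.
have near s : 0 <= s <= 1 -> s < c + delta -> good s.
  move=> /andP[s0 s1] sc; have [st|ts] := leP s t; first by apply: ht; rewrite s0.
  rewrite (hd s) ?s0 // ltr_norml ltrBlDl sc andbT ltrBrDl.
  by apply: lt_trans ts.
suff c_eq1 : c = 1 by move=> s s01; apply: near; rewrite // c_eq1; case/andP: s01 => _ s1; lra.
apply/eqP; rewrite eq_le c1 /= leNgt; apply/negP => lt1.
(* If [c < 1], goodness extends past [c] up to [c'], contradicting the supremum. *)
pose c' := Num.min 1 (c + delta / 2).
have c'c : c < c' by rewrite lt_min lt1 ltrDl divr_gt0.
suff : c' <= c by rewrite leNgt c'c.
apply: ub_le_sup; first by case: supS.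
split=> [|s /andP[s0 sc']].
  by rewrite (le_trans c0 (ltW c'c)) /c' ge_min lexx.
move: sc'; rewrite /c' le_min => /andP[s1 s2]; apply: near; rewrite ?s0 //.
by apply: le_lt_trans s2 _; lra.
Qed.

(** * Gram matrices, averages of frameworks, and rigidity at maximal rank *)

Lemma rigidity_mxE (T : comNzRingType) n d e (q : 'M[T]_(n, d)) v i a b :
  rigidity_mx e q (mxvec_index v i) (mxvec_index a b) =
    if e a b then (q a i - q b i) * ((a == v)%:R - (b == v)%:R) else 0.
Proof.
rewrite /rigidity_mx /lin_mx /lin1_mx mxE /= mxvecE vec_mx_delta mxE; case: ifP => // _.
rewrite (bigD1 i) //= big1 => [|k /negPf ki]; last by rewrite !mxE ki !andbF subrr mulr0.
by rewrite addr0 !mxE eqxx !andbT.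
Qed.

Section Paths.
Variables (R : realType) (n d : nat) (e : rel 'I_n).
Implicit Types p q : 'M[R]_(n, d).

Lemma dist2_polar q a b c c' :
  \sum_i (q a i - q b i) * (q c i - q c' i) =
    (dist2 q a c' + dist2 q b c - dist2 q a c - dist2 q b c') / 2.
Proof.
rewrite /dist2 -!sumrN -!big_split /= mulr_suml; apply: eq_bigr => i _.
by field.
Qed.

(** Its entries are functions of the pairwise distances, by polarization, and over the reals it
    detects the rank of the rigidity matrix. *)
Definition gram q := (rigidity_mx e q)^T *m rigidity_mx e q.

Lemma gramE q a b c c' : gram q (mxvec_index a b) (mxvec_index c c') =
  if e a b && e c c' then
    (\sum_v ((a == v)%:R - (b == v)%:R) * ((c == v)%:R - (c' == v)%:R)) *
    ((dist2 q a c' + dist2 q b c - dist2 q a c - dist2 q b c') / 2)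
  else 0.
Proof.
rewrite mxE (reindex _ (curry_mxvec_bij _ _)) /=.
transitivity (\sum_v \sum_i
    (if e a b then (q a i - q b i) * ((a == v)%:R - (b == v)%:R) else 0) *
    (if e c c' then (q c i - q c' i) * ((c == v)%:R - (c' == v)%:R) else 0)).
  by rewrite pair_bigA; apply: eq_bigr => -[v i] _; rewrite mxE !rigidity_mxE.
case: (e a b) (e c c') => [] [] /=; last 1 first.
- by rewrite big1 // => v _; rewrite big1 // => i _; rewrite mul0r.
- rewrite -dist2_polar mulr_suml; apply: eq_bigr => v _.
  by rewrite mulr_sumr; apply: eq_bigr => i _; ring.
- by rewrite big1 // => v _; rewrite big1 // => i _; rewrite mulr0.
- by rewrite big1 // => v _; rewrite big1 // => i _; rewrite mul0r.
Qed.

Lemma gram_dist2 p q : (forall u v, dist2 p u v = dist2 q u v) -> gram p = gram q.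
Proof.
move=> h; apply/matrixP => x y; case/mxvec_indexP: x => a b; case/mxvec_indexP: y => c c'.
by rewrite !gramE !h.
Qed.

Lemma gram_unit k m (A : 'M[R]_(m, k)) : row_full A -> A^T *m A \in unitmx.
Proof.
move=> /row_fullP[B BA]; rewrite -row_free_unit -kermx_eq0; apply/eqP/row_matrixP => i.
set v := row i _; have vAA : v *m A^T *m A = 0 by rewrite -mulmxA -row_mul mulmx_ker row0.
have w0 : v *m A^T = 0.
  have /matrixP/(_ 0 0) : v *m A^T *m (v *m A^T)^T = 0 by rewrite trmx_mul trmxK mulmxA vAA mul0mx.
  rewrite !mxE => /eqP; under eq_bigr => j _ do rewrite [(_^T) _ _]mxE -expr2.
  rewrite psumr_eq0 => [/allP h|j _]; last exact: sqr_ge0.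
  apply/rowP => j; have := h j; rewrite mem_index_enum sqrf_eq0 => /(_ isT)/eqP ->.
  by rewrite mxE.
by rewrite row0 -[v]mulmx1 -(trmx1 _ k) -BA trmx_mul mulmxA w0 mul0mx.
Qed.

(** The pairing of [(x + y) / 2] with [x - y] is half the difference of the squared norms;
    [dist2_average] reads the same identity backwards. *)
Lemma rigidity_map_average p q : (forall u v, e u v -> dist2 p u v = dist2 q u v) ->
  rigidity_map e (2^-1 *: (p + q)) (p - q) = 0.
Proof.
move=> h; apply/matrixP => a b; rewrite !mxE; case: ifP => // /h hab.
transitivity (2^-1 * (dist2 p a b - dist2 q a b)); last by rewrite hab subrr mulr0.
rewrite /dist2 -sumrN -big_split mulr_sumr; apply: eq_bigr => i _ /=.
by rewrite !mxE; ring.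
Qed.

Lemma dist2_average p q : rigidity_map (@complete n) (2^-1 *: (p + q)) (p - q) = 0 ->
  forall u v, dist2 p u v = dist2 q u v.
Proof.
move=> h u v; move/matrixP/(_ u v): h; rewrite !mxE /= => h.
apply/eqP; rewrite -subr_eq0; apply/eqP; rewrite -[RHS](mulr0 2) -h mulr_sumr.
rewrite /dist2 -sumrN -big_split; apply: eq_bigr => i _ /=.
by rewrite !mxE; field.
Qed.

Lemma cont_at_dist2 t (h : R -> 'M[R]_(n, d)) u v :
  (forall a i, cont_at t (fun s => h s a i)) -> cont_at t (fun s => dist2 (h s) u v).
Proof.
move=> ch; apply: cont_at_sum => i.
have cd : cont_at t (fun s => h s u i + -1 * h s v i).
  by apply: cont_atD => //; apply: cont_atM => //; exact: cont_at_cst.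
by apply: (cont_at_eq _ (cont_atM cd cd)) => s; rewrite mulN1r -expr2.
Qed.

Lemma cont_at_gram t (h : R -> 'M[R]_(n, d)) x y :
  (forall a i, cont_at t (fun s => h s a i)) -> cont_at t (fun s => gram (h s) x y).
Proof.
move=> ch; case/mxvec_indexP: x => a b; case/mxvec_indexP: y => c c'.
have cd := cont_at_dist2 _ _ ch; have cN u v : cont_at t (fun s => - dist2 (h s) u v).
  apply: (cont_at_eq _ (cont_atM (cont_at_cst t (-1)) (cd u v))) => s.
  exact: mulN1r.
have cE := cont_atM (cont_at_cst t (if e a b && e c c' then
    \sum_v ((a == v)%:R - (b == v)%:R) * ((c == v)%:R - (c' == v)%:R) else 0))
  (cont_atM (cont_atD (cont_atD (cont_atD (cd a c') (cd b c)) (cN a c)) (cN b c'))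
     (cont_at_cst t 2^-1)).
by apply: (cont_at_eq _ cE) => s; rewrite gramE; case: ifP; rewrite ?mul0r.
Qed.

(** Along a motion, the times at which all distances agree with those of [P] form a set that is both
    open and closed in the unit interval and contains [0]. *)
Lemma max_rank_rigid (P : 'M[R]_(n, d)) :
  (forall q : 'M[R]_(n, d), (\rank (rigidity_mx (@complete n) q) <= \rank (rigidity_mx e P))%N) ->
  framework_rigid e P.
Proof.
move=> maxP [f [cf f0 fe [t1 [u1 [v1 [t101 /eqP]]]]]]; apply.
have [g0 [g]] := minor_ex (rigidity_mx e P); set r := \rank _ in g0 g * => minorP.
(* A principal minor of the Gram matrix on columns where the rigidity matrix of [P] has full rank:
   it depends only on distances, and [psi q != 0] forces maximal rank at [q]. *)
pose psi q := \det (mxsub g g (gram q)).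
have psiE q : psi q = \det ((colsub g (rigidity_mx e q))^T *m colsub g (rigidity_mx e q)).
  by congr (\det _); apply/matrixP => x y; rewrite !mxE; apply: eq_bigr => k _; rewrite !mxE.
have psiP : psi P != 0.
  rewrite psiE -unitfE -unitmxE; apply: gram_unit.
  rewrite /row_full eqn_leq rank_leq_col /=.
  by apply: (@minor_rank _ _ _ _ _ g0 id); rewrite -mxsub_comp.
have psi_rank q m : psi q != 0 -> rigidity_map e q m = 0 -> rigidity_map (@complete n) q m = 0.
  move=> psiq; apply: rigidity_map_complete; apply: leq_trans (maxP q) _.
  have : (r <= \rank (gram q))%N by apply: minor_rank psiq.
  by move/leq_trans; apply; exact: mxrankM_maxr.
have cf_entry t : 0 <= t <= 1 -> forall a i, cont_at t (fun s => f s a i).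
  by move=> t01 a i eps /(cf t t01)[delta d0 h]; exists delta => // s s01 /(h s s01).
pose good s := [forall u, forall v, dist2 (f s) u v == dist2 P u v].
have goodP s : reflect (forall u v, dist2 (f s) u v = dist2 P u v) (good s).
  apply: (iffP forallP) => [h u v|h u]; first by have /forallP/(_ v)/eqP := h u.
  by apply/forallP => v; rewrite h.
suff /(_ t1 t101)/goodP : forall t, 0 <= t <= 1 -> good t by [].
apply: locally_constant01 => [|t t01]; first by apply/goodP => u v; rewrite f0.
(* At a bad time some distance differs from that in [P], and by continuity it still differs
   nearby. *)
have [/goodP gt|/forallPn[u /forallPn[v gt]]] := boolP (good t); last first.
  have cd : cont_at t (fun s => dist2 (f s) u v + - dist2 P u v).
    by apply: cont_atD; [exact/cont_at_dist2/cf_entry | exact: cont_at_cst].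
  have [|delta d0 hd] := cont_at_neq0 cd; first by rewrite subr_eq0.
  exists delta => // s s01 /(hd s s01); rewrite subr_eq0; apply: contraNF => /goodP ->.
  by [].
(* At a good time [t], the average of [f s] and [f t] keeps maximal rank for [s] near [t]. The
   difference [f s - f t] is a motion of that average for [e], hence for all pairs, so all distances
   agree. *)
have [||delta d0 hd] := @cont_at_neq0 _ t (fun s => psi (2^-1 *: (f s + f t))).
- apply: cont_at_det => i k.
  apply: (@cont_at_eq _ _ (fun s => gram (2^-1 *: (f s + f t)) (g i) (g k))) => [s|].
    by rewrite [RHS]mxE.
  apply: cont_at_gram => a l.
  apply: (@cont_at_eq _ _ (fun s => 2^-1 * (f s a l + f t a l))) => [s|]; first by rewrite !mxE.
  apply: cont_atM; first exact: cont_at_cst.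
  by apply: cont_atD; [exact: cf_entry | exact: cont_at_cst].
- rewrite (_ : 2^-1 *: (f t + f t) = f t); last first.
    by rewrite -mulr2n -scaler_nat scalerA mulVf ?scale1r ?pnatr_eq0.
  by rewrite /psi (gram_dist2 gt).
exists delta => // s s01 /(hd s s01) psis; apply/goodP => u v.
rewrite -gt; apply: dist2_average; apply: psi_rank => //; apply: rigidity_map_average => u' v' euv.
by rewrite !fe.
Qed.
End Paths.

Theorem theorem1p3 (R : realType) (n d : nat) (e : rel 'I_n) :
  (0 < n)%N -> (0 < d)%N -> simple_graph e ->
  eta_ge e (n + 3 * d - 3) ->
  d_rigid R d e.
Proof.
move=> n0 d0 [_ irr] ore P genP; apply: max_rank_rigid => q.
by apply: generic_max_rank => // u; exact/negbTE/irr.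
Qed.
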